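(* Let $N\ge1$, $u>0$, $D_1,\dots,D_N>0$, $\gamma_n=D_n/\sum_iD_i$. Suppose each $c_n:\mathbb{R}\to\mathbb{R}$ is continuous, satisfies $c_n(s)=0$ for $s\le0$, is convex and strictly increasing on $[0,\infty)$, and satisfies $\frac{\partial^+c_n(z)}{\partial z}\big|_{z=0}\ge\frac{\gamma_nu}{2}$. Let $(\mathbf{b}^a,d^a,p^a)$ be the price-anticipating equilibrium in the voluntary demand response market with bids satisfying $u\ge\frac{\sum_ib_i^a}{\sum_iD_i}$, let $s_n^a=S_n(b_n^a,p^a)$, and let $(\mathbf{s}^*,d^* )$ be an optimal solution of the social utility maximization problem. Then $$ud^a-\sum_nc_n(s_n^a)\ \ge\ ud^*-\sum_nc_n(s_n^* )-\frac u2\left(\sum_nD_n\gamma_n+\frac{(d^* )^2}{\sum_nD_n}\right).$$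
   Context: Voluntary demand response: $N$ tenants, tenant $n$ with reduction capacity $D_n$ and cost $c_n(s_n)$; the operator receives reward $u$ per unit of reduction. Social utility maximization problem: $$\max_{d,\mathbf{s}}\ ud-\sum_ic_i(s_i)\quad\text{s.t.}\quad\sum_is_i=d,\quad0\le s_i\le D_i.$$ Supply function: $S_n(b_n,p)=D_n-\frac{b_n}{p}$. Payoff of a price-anticipating tenant (obtained with $p=\sqrt{u\sum_ib_i/\sum_iD_i}$): for $\sum_mb_m>0$, $$Q_n(b_n;\mathbf{b}_{-n})=\gamma_n\sqrt{\textstyle\sum_mb_m}\sqrt{u\textstyle\sum_iD_i}-b_n-c_n\!\left(D_n-\frac{b_n}{\sqrt{\sum_mb_m}}\sqrt{\frac{\sum_iD_i}{u}}\right).$$ A price-anticipating equilibrium is a triple $(\mathbf{b},d,p)$ with $\mathbf{b}\ge0$ such that $Q_n(b_n;\mathbf{b}_{-n})\ge Q_n(\bar b_n;\mathbf{b}_{-n})$ for all $n$ and all $\bar b_n\ge0$ for which this is defined; $p=\frac{\sum_ib_i}{\sum_iD_i-d}$; and $d\in\arg\max_{0\le d'\le\sum_iD_i}\Bigl(u-\frac{\sum_ib_i}{\sum_iD_i-d'}\Bigr)d'$. $\partial^+$ denotes right derivative. *)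

(* Defs.v *)
From HB Require Import structures.
From mathcomp Require Export all_boot all_order all_algebra.
From mathcomp Require Export all_classical all_reals all_analysis.

Set Implicit Arguments.
Unset Strict Implicit.
Unset Printing Implicit Defensive.

Import Order.TTheory GRing.Theory Num.Theory.
Import numFieldNormedType.Exports.

Local Open Scope classical_set_scope.
Local Open Scope ring_scope.

(* [lim] is a junk value when the one-sided limit does not exist.  For a
   function that is convex and nondecreasing on [x, +oo[ it does exist, since
   the difference quotient is nondecreasing in h and bounded below by 0. *)
Definition right_derivative (R : realType) (f : R -> R) (x : R) : R :=
  lim ((f (x + h) - f x) / h @[h --> 0^'+]).

Section Market.
Context {R : realType} {N : nat}.
Implicit Types (u d p : R) (D b s : 'I_N -> R) (c : 'I_N -> R -> R).

Definition capacity_share D (n : 'I_N) : R := D n / \sum_i D i.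

Definition supply D (n : 'I_N) (bn p : R) : R := D n - bn / p.

Definition utility u c d s : R := u * d - \sum_i c i (s i).

Definition social_feasible D s d : Prop :=
  \sum_i s i = d /\ (forall i, 0 <= s i <= D i).

Definition social_optimum u D c s d : Prop :=
  social_feasible D s d /\
  (forall s' d', social_feasible D s' d' -> utility u c d' s' <= utility u c d s).

(* Meaningful only for profiles b with a positive total bid. *)
Definition payoff u D c (n : 'I_N) b : R :=
  capacity_share D n * Num.sqrt (\sum_m b m) * Num.sqrt (u * \sum_i D i)
  - b n
  - c n (D n - b n / Num.sqrt (\sum_m b m) * Num.sqrt ((\sum_i D i) / u)).

Definition operator_profit u D b d : R :=
  (u - (\sum_i b i) / (\sum_i D i - d)) * d.

Definition deviation b (n : 'I_N) (x : R) : 'I_N -> R :=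
  fun m => if m == n then x else b m.

(* Payoffs are compared only where they are defined, i.e. where the total bid
   is positive; in particular b itself must have a positive total bid.
   The operator's profit is undefined (it tends to -oo) at d' = \sum_i D i, but
   division by zero is total here and would give the spurious value
   u * \sum_i D i there; hence the strict upper bounds on d and d'. *)
Definition anticipating_equilibrium u D c b d p : Prop :=
  [/\ (forall n, 0 <= b n) /\ 0 < \sum_i b i,
      forall (n : 'I_N) (x : R), 0 <= x ->
        0 < \sum_i deviation b n x i ->
        payoff u D c n (deviation b n x) <= payoff u D c n b,
      p = (\sum_i b i) / (\sum_i D i - d),
      0 <= d < \sum_i D i
    & forall d', 0 <= d' < \sum_i D i ->
        operator_profit u D b d' <= operator_profit u D b d].

End Market.

(* Main.v *)
(* At an equilibrium the price satisfies p^2 * sum D = u * sum b, because the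
   operator minimises u * y + (sum b * sum D) / y over y = sum D - d.  A tenant's
   payoff is compared with its payoffs at nearby bids; this gives the first-order
   condition that g = (2 p - gamma_n u) / (2 - b_n / sum b) is a subgradient of
   c_n at s_n relative to [0, D_n].  Hence the loss of utility is at most
   sum_n (u - g_n) (s*_n - s_n) = (u - p) (d* - d) + sum_n (p - g_n) (s*_n - s_n).
   Since u - p = u d / sum D, the first term is at most u d*^2 / (4 sum D); since
   p - g_n lies between 0 and u s_n / sum D and s*_n <= D_n, the n-th term of the
   sum is at most u D_n^2 / (4 sum D). *)
Require Import Defs.
From mathcomp Require Import all_boot all_order all_algebra.
From mathcomp Require Import all_classical all_reals all_analysis.
From mathcomp Require Import ring lra.

Import Order.TTheory GRing.Theory Num.Theory.
Import numFieldNormedType.Exports.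

Local Open Scope classical_set_scope.
Local Open Scope ring_scope.

(** * Convexity on the half-line and small perturbations *)

Lemma convex_function_ge0 {R : realType} {f : R -> R} {x y l : R} :
  convex_function (`[0, +oo[%classic : set R) f ->
  0 <= x -> 0 <= y -> 0 <= l -> l <= 1 ->
  f (l * x + (1 - l) * y) <= l * f x + (1 - l) * f y.
Proof.
move=> cvx x0 y0 l0 l1.
have := cvx (Itv01 l0 l1) x y; rewrite !convRE; apply;
  by rewrite inE /= in_itv /= ?x0 ?y0.
Qed.

(** Stands in for a limit argument: a strict inequality at one bid persists at a nearby one. *)
Lemma small_quadratic_gt0 {R : realFieldType} {a : R} (b c : R) {d : R} :
  0 < a -> 0 < d -> exists2 h : R, 0 < h < d & 0 < a + h * b + h ^+ 2 * c.
Proof.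
move=> a0 d0; pose M := `|b| + `|c| + 1.
have b0 : 0 <= `|b| by []. have c0 : 0 <= `|c| by [].
have M0 : 0 < M by rewrite /M; lra.
(* Since [h <= 1], the square of [h] is at most [h], so the perturbation is smaller than [h * M],
   hence than [a / 2]. *)
pose h := Num.min (Num.min (d / 2) 1) (a / (2 * M)).
have h0 : 0 < h by rewrite !lt_min divr_gt0 // ltr01 divr_gt0 // mulr_gt0.
have hd : h <= d / 2 by rewrite !ge_min lexx.
have h1 : h <= 1 by rewrite !ge_min lexx orbT.
have hM : h * (2 * M) <= a by rewrite -ler_pdivlMr ?mulr_gt0 // !ge_min lexx orbT.
exists h; first by rewrite h0 /=; lra.
have hb : - (h * `|b|) <= h * b by rewrite -mulrN ler_pM2l // lerNl -normrN ler_norm.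
have hc : - (h * `|c|) <= h ^+ 2 * c.
  rewrite expr2 -mulrA -mulrN ler_pM2l // lerNl -mulrN.
  apply: le_trans (_ : h * `|c| <= _); last by rewrite ler_piMl.
  by rewrite ler_pM2l // -normrN ler_norm.
move: hM; rewrite /M => hM; nra.
Qed.

(** * First-order condition for a best response *)

Section BestResponse.
Context (R : realType) (c : R -> R) (cap k e r0 : R).
Context (c_npos : forall s, s <= 0 -> c s = 0)
  (c_convex : convex_function (`[0, +oo[%classic : set R) c)
  (k0 : 0 < k) (cap0 : 0 < cap) (e0 : 0 <= e) (r00 : 0 < r0) (er0 : e <= r0 ^+ 2).

(* A tenant whose rivals bid [e] in total is described by the square root [r] of
   the total bid rather than by its own bid [r ^+ 2 - e]: with
   [k = sqrt (\sum_i D i / u)] its supply is [S r] and its revenue [cap / k * r]. *)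
Let S r := cap - k * (r - e / r).

Context (best : forall r, 0 < r -> e <= r ^+ 2 ->
  cap / k * r - (r ^+ 2 - e) - c (S r) <=
  cap / k * r0 - (r0 ^+ 2 - e) - c (S r0)).

(** If the supply were negative, a slightly smaller total bid would keep the cost at zero.
    Negativity also forces [cap / k < r0], where revenue minus bid decreases in [r], so this
    deviation would pay more. *)
Lemma best_response_supply_ge0 : 0 <= S r0.
Proof.
rewrite leNgt; apply/negP => Sneg.
have SrE r : 0 < r -> S r * r = cap * r - k * (r ^+ 2 - e).
  by move=> r_gt0; rewrite /S; field; rewrite gt_eqF.
have A0 : 0 < k * (r0 ^+ 2 - e) - cap * r0.
  have : S r0 * r0 < 0 by rewrite pmulr_llt0.
  by rewrite SrE //; lra.
have gr0 : cap / k < r0.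
  rewrite ltr_pdivrMr // -(ltr_pM2r r00).
  have : 0 <= k * e by rewrite mulr_ge0 // ltW.
  by nra.
have [h /andP[h0 hr0] hpos] := small_quadratic_gt0 (cap - 2 * k * r0) k A0 r00.
have r_gt0 : 0 < r0 - h by lra.
have Ar : 0 < k * ((r0 - h) ^+ 2 - e) - cap * (r0 - h).
  by apply: lt_le_trans hpos _; rewrite le_eqVlt; apply/orP; left; apply/eqP; ring.
have er : e <= (r0 - h) ^+ 2.
  rewrite -subr_ge0 -(pmulr_rge0 _ k0).
  have : 0 < cap * (r0 - h) by rewrite mulr_gt0.
  by lra.
have Sr : S (r0 - h) <= 0.
  by rewrite -(pmulr_lle0 _ r_gt0) SrE //; lra.
have := best _ r_gt0 er; rewrite (c_npos _ Sr) (c_npos _ (ltW Sneg)).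
by move: gr0; set g := cap / k => gr0; nra.
Qed.

(** [S r] is the convex combination of [t] and [s] with weight [l] on [t], so convexity of [c] and
    optimality of [r0] compare revenue with cost. Dividing by [m] and multiplying by [r] leaves both
    sides polynomial in [r], ready for [r] to approach [r0]. *)
Lemma deviation_bound t r (s := S r0) (m := (r0 - r) / (t - s)) :
  0 <= t -> 0 <= s -> 0 < r -> e <= r ^+ 2 ->
  0 < m -> m * (k * (1 + e / (r * r0))) <= 1 ->
  (t - s) * (r * (r + r0 - cap / k)) <= (c t - c s) * (k * (r + e / r0)).
Proof.
move=> t0 s0 r_gt0 er m0; set l := m * _ => l1.
have ts : t - s != 0.
  by apply: contraL m0 => /eqP z; rewrite /m z invr0 mulr0 ltxx.
have mts : m * (t - s) = r0 - r by rewrite divfK.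
have rn0 : r != 0 by rewrite gt_eqF.
have r0n0 : r0 != 0 by rewrite gt_eqF.
have l0 : 0 <= l.
  apply: mulr_ge0; first exact: ltW.
  apply: mulr_ge0; first exact: ltW.
  by rewrite addr_ge0 // divr_ge0 ?mulr_ge0 // ltW.
have Srl : S r = l * t + (1 - l) * s.
  have -> : l * t + (1 - l) * s = s + (m * (t - s)) * (k * (1 + e / (r * r0))).
    by rewrite /l; ring.
  by rewrite mts /s /S; field; rewrite r0n0 rn0.
have := convex_function_ge0 c_convex t0 s0 l0 l1; rewrite -Srl => cS.
have := best _ r_gt0 er; rewrite -/s => br.
have H : m * ((t - s) * (r + r0 - cap / k)) <= l * (c t - c s).
  by rewrite mulrA mts; move: br cS; set g := cap / k => *; nra.
move: H; rewrite /l -(mulrA m) ler_pM2l // => H.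
have := H; rewrite -(ler_pM2r r_gt0).
rewrite (_ : k * _ * _ * r = (c t - c s) * (k * (r + e / r0))); last first.
  by field; rewrite r0n0 rn0.
by rewrite -mulrA (mulrC _ r).
Qed.

(** The limit of [deviation_bound] as [r] tends to [r0], taken by contradiction. *)
Lemma best_response_subgradient t (s := S r0) : 0 <= t -> t <= cap ->
  (t - s) * (r0 * (r0 + r0 - cap / k)) <= (c t - c s) * (k * (r0 + e / r0)).
Proof.
move=> t0 tcap; have s0 : 0 <= s := best_response_supply_ge0.
rewrite leNgt -subr_gt0; apply/negP; set A := _ - _ => A0.
have r0n0 : r0 != 0 by rewrite gt_eqF.
set dc := c t - c s in A A0.
pose slope := (t - s) * (3 * r0 - cap / k) - dc * k.
(* The violated inequality stays violated at a nearby [r], on the side of [r0]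
   from which the supply moves towards [t]. *)
have expand r :
   (t - s) * (r * (r + r0 - cap / k)) - dc * (k * (r + e / r0)) =
   A + (r - r0) * slope + (r - r0) ^+ 2 * (t - s).
  by rewrite /A /slope; field; rewrite r0n0 gt_eqF.
(* Makes the requirement that the convex weight be at most 1 uniform over [r >= r0 / 2]. *)
have bound r : 0 < r -> r0 <= 2 * r -> k * (1 + e / (r * r0)) <= 3 * k.
  move=> rp r2; rewrite mulrC ler_pM2r //.
  suff : e / (r * r0) <= 2 by lra.
  rewrite ler_pdivrMr ?mulr_gt0 //.
  by apply: le_trans er0 _; rewrite mulrA expr2 ler_pM2r.
have near_r0 r : 0 < r -> r0 <= 2 * r -> e <= r ^+ 2 -> 0 < (r0 - r) / (t - s) ->
   (r0 - r) / (t - s) * (3 * k) <= 1 ->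
   0 < A + (r - r0) * slope + (r - r0) ^+ 2 * (t - s) -> False.
  move=> rp r2 er m0 m1; rewrite -expand subr_gt0 ltNge => /negP; apply.
  apply: deviation_bound => //; apply: le_trans m1; rewrite ler_pM2l //; exact: bound.
have [ts|st|E] := ltgtP t s; last first.
- by move: A0; rewrite /A /dc E !subrr !mul0r subrr ltxx.
(* Here [s < t <= cap], so the tenant's own bid is positive and can be lowered. *)
- have e_lt : e < r0 ^+ 2.
    have : 0 < k * (r0 - e / r0) by move: st; rewrite /s /S; lra.
    by rewrite pmulr_rgt0 // subr_gt0 ltr_pdivrMr.
  (* The three bounds keep, in order, [r0 <= 2 * r], the own bid nonnegative, and the convex weight
     at most 1. *)
  pose d := Num.min (Num.min (r0 / 2) ((r0 ^+ 2 - e) / (2 * r0)))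
    ((t - s) / (3 * k)).
  have d0 : 0 < d.
    by rewrite !lt_min !divr_gt0 ?mulr_gt0 ?subr_gt0.
  have [h /andP[h0 hd] hpos] := small_quadratic_gt0 (- slope) (t - s) A0 d0.
  move: hd; rewrite !lt_min -andbA => /and3P[h1 h2 h3].
  move: h2 h3; rewrite !ltr_pdivlMr ?mulr_gt0 // => h2 h3.
  apply: (near_r0 (r0 - h)).
  + by lra.
  + by lra.
  + by nra.
  + by rewrite divr_gt0 ?subr_gt0 //; lra.
  + by rewrite mulrAC ler_pdivrMr ?subr_gt0 //; lra.
  + by apply: lt_le_trans hpos _; rewrite le_eqVlt; apply/orP; left; apply/eqP; ring.
(* Raising the bid is always admissible, so only the convex weight limits the step. *)
- pose d := (s - t) / (3 * k).
  have d0 : 0 < d by rewrite divr_gt0 ?mulr_gt0 ?subr_gt0.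
  have [h /andP[h0 hd] hpos] := small_quadratic_gt0 slope (t - s) A0 d0.
  move: hd; rewrite ltr_pdivlMr ?mulr_gt0 // => hd.
  have rp : 0 < r0 + h by rewrite addr_gt0.
  have mE : (r0 - (r0 + h)) / (t - s) = h / (s - t).
    by rewrite -(opprB s t) invrN mulrN -mulNr; congr (_ / _); ring.
  apply: (near_r0 (r0 + h)) => //.
  + by lra.
  + by apply: le_trans er0 _; rewrite ler_sqr ?nnegrE ?ltW // ltrDl.
  + by rewrite mE divr_gt0 ?subr_gt0.
  + by rewrite mE mulrAC ler_pdivrMr ?subr_gt0 // mul1r ltW.
  + by apply: lt_le_trans hpos _; rewrite le_eqVlt; apply/orP; left; apply/eqP; ring.
Qed.
End BestResponse.

(** * Price, first-order conditions and losses at an equilibrium *)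

Section Equilibrium.
Context {R : realType} {N : nat}.
Implicit Types (u d p r : R) (D b : 'I_N -> R) (c : 'I_N -> R -> R).

Lemma sum_deviation b n x :
  \sum_i deviation b n x i = x + (\sum_i b i - b n).
Proof.
rewrite (bigD1 n) //= (bigD1 n (F := b)) //= /deviation eqxx addrC (addrC (b n)) addrK.
by rewrite addrC; congr (_ + _); apply: eq_bigr => i /negbTE ->.
Qed.

(** Passes to the parameter [r] of the best-response analysis: the square root of [u * T] is
    [T / k], and this [T] cancels the denominator of the capacity share. *)
Lemma payoffE u D c n b r : 0 < u -> 0 < \sum_i D i -> 0 < r ->
  \sum_i b i = r ^+ 2 ->
  let k := Num.sqrt ((\sum_i D i) / u) in
  payoff u D c n b =
  D n / k * r - b n - c n (D n - k * (r - (r ^+ 2 - b n) / r)).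
Proof.
move=> u0 T0 r_gt0 sb k; set T := \sum_i D i in T0 k *.
have k0 : 0 < k by rewrite sqrtr_gt0 divr_gt0.
have kE : Num.sqrt (u * T) = T / k.
  apply/(mulIf (lt0r_neq0 k0)); rewrite divfK ?gt_eqF // -sqrtrM ?mulr_ge0 ?ltW //.
  rewrite (_ : u * T * (T / u) = T ^+ 2); first by rewrite sqrtr_sqr gtr0_norm.
  by field; rewrite gt_eqF.
rewrite /payoff sb sqrtr_sqr gtr0_norm // kE /capacity_share -/T -/k.
congr (_ - _ - c n _); field; rewrite ?gt_eqF //.
Qed.

Lemma operator_optimum u D b d : 0 < u -> 0 < \sum_i D i -> 0 < \sum_i b i ->
  (\sum_i b i) / \sum_i D i <= u -> 0 <= d < \sum_i D i ->
  (forall d', 0 <= d' < \sum_i D i ->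
     operator_profit u D b d' <= operator_profit u D b d) ->
  (\sum_i D i - d) ^+ 2 * u = (\sum_i b i) * \sum_i D i.
Proof.
rewrite /operator_profit; set T := \sum_i D i; set B := \sum_i b i.
move=> u0 T0 B0; rewrite ler_pdivrMr // => BT /andP[d0 dT] opt.
pose y := Num.sqrt (B * T / u).
have y0 : 0 < y by rewrite sqrtr_gt0 divr_gt0 ?mulr_gt0.
have y2 : y ^+ 2 * u = B * T.
  by rewrite sqr_sqrtr ?divfK ?gt_eqF // divr_ge0 ?mulr_ge0 // ltW.
(* The bid condition makes the candidate maximiser [T - y] of the profit nonnegative, hence
   feasible. *)
have yT : y <= T.
  have : y ^+ 2 <= T ^+ 2 by rewrite -(ler_pM2r u0) y2 expr2 mulrAC ler_pM2r // mulrC.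
  by rewrite ler_sqr // nnegrE ltW.
pose z := T - d; have z0 : 0 < z by rewrite subr_gt0.
suff -> : T - d = y by [].
have := opt (T - y); rewrite subr_ge0 yT ltrBlDr ltrDl y0 => /(_ isT).
rewrite (_ : T - (T - y) = y) -/z; last by ring.
have -> : d = T - z by rewrite /z; ring.
rewrite -subr_ge0 => H.
(* Completing the square: replacing [y] by [z] costs [u * (z - y) ^+ 2 / z], so optimality forces
   [z = y]. *)
have E : (u - B / z) * (T - z) - (u - B / y) * (T - y) = - (u * (z - y) ^+ 2 / z).
  have -> : B = y ^+ 2 * u / T by rewrite y2 mulfK ?gt_eqF.
  by field; rewrite !gt_eqF.
move: H; rewrite E oppr_ge0 pmulr_lle0 ?invr_gt0 // pmulr_rle0 // => H.
by apply/eqP; rewrite -subr_eq0 -sqrf_eq0 eq_le H sqr_ge0.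
Qed.

Lemma anticipating_equilibrium_price u D c b d p : 0 < u -> 0 < \sum_i D i ->
  (\sum_i b i) / \sum_i D i <= u -> anticipating_equilibrium u D c b d p ->
  [/\ 0 < p, p ^+ 2 * \sum_i D i = u * \sum_i b i &
      d = (\sum_i D i) * (1 - p / u)].
Proof.
move=> u0 T0 bid [[b0 B0] _ pE /[dup] /andP[d0 dT] dI opt].
have := operator_optimum _ _ _ _ u0 T0 B0 bid dI opt.
rewrite pE -subr_gt0 in dT *.
move: T0 B0 dT; set T := \sum_i D i; set B := \sum_i b i; set z := T - d => T0 B0 z0 zE.
split; first by rewrite divr_gt0.
  have -> : T = z ^+ 2 * u / B by rewrite zE mulrAC divff ?mul1r ?gt_eqF.
  by field; rewrite !gt_eqF.
have -> : B = z ^+ 2 * u / T by rewrite zE mulfK ?gt_eqF.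
have -> : d = T - z by rewrite /z; ring.
by field; rewrite !gt_eqF.
Qed.

Lemma anticipating_equilibrium_subgradient u D c b d p n :
  0 < u -> (forall i, 0 < D i) ->
  (forall s, s <= 0 -> c n s = 0) ->
  convex_function (`[0, +oo[%classic : set R) (c n) ->
  (\sum_i b i) / \sum_i D i <= u ->
  anticipating_equilibrium u D c b d p ->
  let s := supply D n (b n) p in
  0 <= s /\ forall t, 0 <= t -> t <= D n ->
    (t - s) * (2 * p - capacity_share D n * u) <=
    (c n t - c n s) * (2 - b n / \sum_i b i).
Proof.
move=> u0 D0 c_npos c_cvx bid eqm s.
have T0 : 0 < \sum_i D i.
  by rewrite (bigD1 n) //= ltr_wpDr // sumr_ge0 // => i _; apply: ltW.
have [p0 p2 _] := anticipating_equilibrium_price _ _ _ _ _ _ u0 T0 bid eqm.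
have [[b0 B0] best _ _ _] := eqm.
have bB : b n <= \sum_i b i.
  by rewrite (bigD1 n) //= lerDl sumr_ge0.
pose k := Num.sqrt ((\sum_i D i) / u).
have k0 : 0 < k by rewrite sqrtr_gt0 divr_gt0.
have k2 : k ^+ 2 = (\sum_i D i) / u by rewrite sqr_sqrtr // ltW // divr_gt0.
(* By [p2], [p * k] is the square root of the total bid; [e] is the total bid of the rivals. *)
pose e := \sum_i b i - b n; pose r0 := p * k.
have r00 : 0 < r0 by rewrite mulr_gt0.
have r02 : r0 ^+ 2 = \sum_i b i.
  by rewrite exprMn k2 mulrA p2 mulrAC divff ?mul1r ?gt_eqF.
have e0 : 0 <= e by rewrite subr_ge0.
have er0 : e <= r0 ^+ 2 by rewrite r02 gerBl.
have br r : 0 < r -> e <= r ^+ 2 ->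
    D n / k * r - (r ^+ 2 - e) - c n (D n - k * (r - e / r)) <=
    D n / k * r0 - (r0 ^+ 2 - e) - c n (D n - k * (r0 - e / r0)).
  move=> r_gt0 er.
  have sd : \sum_i deviation b n (r ^+ 2 - e) i = r ^+ 2.
    by rewrite sum_deviation -/e subrK.
  have := best n (r ^+ 2 - e); rewrite subr_ge0 er sd exprn_gt0 // => /(_ isT isT).
  rewrite (payoffE _ _ _ _ _ _ u0 T0 r_gt0 sd).
  rewrite (payoffE _ _ _ _ _ _ u0 T0 r00 (esym r02)) -/k.
  have xn : deviation b n (r ^+ 2 - e) n = r ^+ 2 - e by rewrite /deviation eqxx.
  rewrite xn.
  have -> : r ^+ 2 - (r ^+ 2 - e) = e by ring.
  have -> : r0 ^+ 2 - b n = e by rewrite r02.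
  by have -> : r0 ^+ 2 - e = b n by rewrite r02 /e; ring.
have sE : D n - k * (r0 - e / r0) = s.
  rewrite /s /supply; congr (_ - _).
  have -> : e = r0 ^+ 2 - b n by rewrite r02.
  by rewrite /r0; field; rewrite !gt_eqF.
have S0 := best_response_supply_ge0 _ _ _ _ _ _ c_npos k0 (D0 n) e0 r00 br.
have SG := best_response_subgradient _ _ _ _ _ _ c_npos c_cvx k0 (D0 n) e0 r00 er0 br.
rewrite sE in S0 SG; split=> // t t0 tD.
(* Scaled by this factor, the claim becomes the best-response inequality times [r0], because
   [D n / k ^+ 2] is the capacity share times [u]. *)
have kB : 0 < k * \sum_i b i by rewrite mulr_gt0.
rewrite -(ler_pM2r kB).
have -> : (t - s) * (2 * p - capacity_share D n * u) * (k * \sum_i b i) =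
    (t - s) * (r0 * (r0 + r0 - D n / k)) * r0.
  have -> : capacity_share D n * u = D n / k ^+ 2.
    by rewrite /capacity_share k2 invf_div mulrA mulrAC.
  by rewrite -r02 /r0; field; rewrite gt_eqF.
have -> : (c n t - c n s) * (2 - b n / \sum_i b i) * (k * \sum_i b i) =
    (c n t - c n s) * (k * (r0 + e / r0)) * r0.
  have -> : e = r0 ^+ 2 - b n by rewrite r02.
  by rewrite -r02; field; rewrite gt_eqF.
by rewrite ler_pM2r //; apply: SG.
Qed.

(* The left-hand side is at most [(p - g) * (t - s)] for the subgradient [g] of the
   cost at [s]; the first-order condition gives [(2 - x) * (p - g) = u * s / T] for the
   bid share [x := bn / B <= 1]. *)
Lemma tenant_loss_bound (u T B p bn cap s t dc : R) :
  s = cap - bn / p ->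
  0 < u -> 0 < T -> 0 < B -> 0 < p -> 0 <= bn <= B ->
  p ^+ 2 * T = u * B -> 0 <= s ->
  0 <= t <= cap -> (t - s) * (2 * p - cap / T * u) <= dc * (2 - bn / B) ->
  p * (t - s) - dc <= u * cap ^+ 2 / (4 * T).
Proof.
move=> sE u0 T0 B0 p0 /andP[bn0 bnB] pT s0 /andP[t0 tcap] H.
have BE : B = p ^+ 2 * T / u by rewrite pT mulrAC divff ?mul1r ?gt_eqF.
pose x := bn / B; have x1 : x <= 1 by rewrite ler_pdivrMr // mul1r.
have E : (2 - x) * (p * (t - s) - dc) =
    u / T * (s * (t - s)) + ((t - s) * (2 * p - cap / T * u) - dc * (2 - x)).
  by rewrite /x sE BE; field; rewrite !gt_eqF.
have quad : s * (t - s) <= cap ^+ 2 / 4.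
  have : s * (cap - s) <= cap ^+ 2 / 4 by have := sqr_ge0 (cap / 2 - s); nra.
  by apply: le_trans; rewrite ler_wpM2l // lerD2r.
set Y := p * _ - _ in E *; have -> : u * cap ^+ 2 / (4 * T) = u / T * (cap ^+ 2 / 4).
  by field; rewrite gt_eqF.
have uT : 0 < u / T by rewrite divr_gt0.
have YZ : (2 - x) * Y <= u / T * (cap ^+ 2 / 4).
  by rewrite E -[leRHS]addr0 lerD ?ler_pM2l ?subr_le0.
have Z0 : 0 <= u / T * (cap ^+ 2 / 4) by rewrite mulr_ge0 ?divr_ge0 ?sqr_ge0 // ltW.
(* For positive [Y], [2 - x >= 1] gives [Y <= (2 - x) * Y]; otherwise the bound is trivial. *)
have [Y0|Y0] := leP Y 0; first exact: le_trans Y0 Z0.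
by apply: le_trans YZ; rewrite ler_peMl ?(ltW Y0) //; lra.
Qed.

End Equilibrium.

Theorem theorem18 (R : realType) (N : nat) (u : R) (D : 'I_N -> R)
    (c : 'I_N -> R -> R)
    (ba : 'I_N -> R) (da pa : R) (sstar : 'I_N -> R) (dstar : R)
    (hN : (1 <= N)%N) (hu : 0 < u) (hD : forall n, 0 < D n)
    (c_cont : forall n, continuous (c n))
    (c_npos : forall n s, s <= 0 -> c n s = 0)
    (c_convex : forall n, convex_function (`[0, +oo[%classic : set R) (c n))
    (c_incr : forall n, {in `[0, +oo[ &, {homo c n : x y / x < y}})
    (c_slope : forall n,
       right_derivative (c n) 0 >= capacity_share D n * u / 2)
    (heq : anticipating_equilibrium u D c ba da pa)
    (hbid : u >= (\sum_i ba i) / \sum_i D i)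
    (hopt : social_optimum u D c sstar dstar) :
  u * da - \sum_n c n (supply D n (ba n) pa) >=
  u * dstar - \sum_n c n (sstar n)
  - u / 2 * (\sum_n D n * capacity_share D n + dstar ^+ 2 / \sum_n D n).
Proof.
have [[ba0 B0] _ _ /andP[da0 daT] _] := heq.
have T0 := le_lt_trans da0 daT.
have [p0 pT daE] := anticipating_equilibrium_price _ _ _ _ _ _ hu T0 hbid heq.
have [[sum_sstar sstar_itv] _] := hopt.
set loss := \sum_n D n * capacity_share D n; pose s n := supply D n (ba n) pa.
have loss0 : 0 <= loss.
  by apply: sumr_ge0 => n _; rewrite mulr_ge0 ?divr_ge0 // ltW.
have tenants :
    \sum_n (pa * (sstar n - s n) - (c n (sstar n) - c n (s n))) <= u / 4 * loss.
  rewrite mulr_sumr; apply: ler_sum => n _.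
  have [s0 sg] := anticipating_equilibrium_subgradient _ _ _ _ _ _ n
    hu hD (c_npos n) (c_convex n) hbid heq.
  have /andP[t0 tD] := sstar_itv n.
  have -> : u / 4 * (D n * capacity_share D n) = u * D n ^+ 2 / (4 * \sum_i D i).
    by rewrite /capacity_share; field; rewrite gt_eqF.
  apply: (tenant_loss_bound _ _ _ _ _ _ _ _ _ (erefl (s n)) hu T0 B0 p0 _ pT s0 _
    (sg _ t0 tD)).
    by rewrite ba0 (bigD1 n) //= lerDl sumr_ge0.
  by rewrite t0.
(* The market clears: the total supply is [T - B / pa], and the price identity turns it into
   [T * (1 - pa / u)], where [T] and [B] are the total capacity and bid. *)
have sum_s : \sum_n s n = da.
  rewrite sumrB -mulr_suml daE.
  have -> : \sum_i ba i = pa ^+ 2 * (\sum_i D i) / u.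
    by rewrite pT mulrAC divff ?mul1r ?gt_eqF.
  by field; rewrite !gt_eqF.
move: tenants; rewrite !sumrB -mulr_sumr sumrB sum_sstar sum_s.
set T := \sum_i D i in T0 pT daE *.
set C := \sum_i c i (sstar i); set Ca := \sum_i c i (s i) => tenants.
(* Comes down to [da * (dstar - da) <= dstar ^+ 2 / 4]. *)
have operator : (u - pa) * (dstar - da) <= u / 4 * (dstar ^+ 2 / T).
  have -> : u - pa = u / T * da by rewrite daE; field; rewrite !gt_eqF.
  have -> : u / 4 * (dstar ^+ 2 / T) = u / T * (dstar ^+ 2 / 4) by field; rewrite gt_eqF.
  rewrite -mulrA ler_pM2l ?divr_gt0 //.
  by have := sqr_ge0 (dstar / 2 - da); nra.
(* Both loss bounds carry the factor [u / 4]; nonnegativity of the two terms relaxes it to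
   [u / 2]. *)
have d0 : 0 <= dstar ^+ 2 / T by rewrite divr_ge0 ?sqr_ge0 // ltW.
have ul : 0 <= u * loss by rewrite mulr_ge0 // ltW.
have ud : 0 <= u * (dstar ^+ 2 / T) by rewrite mulr_ge0 // ltW.
by move: tenants operator; set q := dstar ^+ 2 / T in ud *; nra.
Qed.
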